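(* Let $\sigma_x,\sigma_u>0$ and $\beta\in(0,1)$ be given, and consider the system without process noise ($d(k)=0$ for all $k$). Suppose there exist matrices $\bar P\in\mathbb{R}^{n_x\times n_x}$, $L\in\mathbb{R}^{n_u\times n_x}$, $G\in\mathbb{R}^{n_u\times n_u}$ and scalars $\bar\alpha_1,\bar\alpha_2,\theta_0,\dots,\theta_{T-1}$ such that $\bar P$ is symmetric positive definite, $\bar\alpha_1\ge 0$, $\bar\alpha_2\ge 0$, $\theta_0\ge0,\dots,\theta_{T-1}\ge 0$, and $$\begin{bmatrix}\mathcal{T}(\bar P) & \mathcal{B}_1(\bar P,L,-G) & 0\\ * & \mathrm{blkdiag}(\beta\bar P,\ 2\bar P-\bar\alpha_1 I,\ G^\top+G-\bar\alpha_2 I) & \mathcal{B}_2(L^\top,\bar P)\\ * & * & \mathrm{blkdiag}\left(\frac{\bar\alpha_2}{\sigma_u^2}I_{n_u},\ \frac{\bar\alpha_1}{\sigma_x^2}I_{n_x}\right)\end{bmatrix}\succeq 0 .$$ Then, with the controller gain $K=L\bar P^{-1}$, for every $(A,B)\in\Sigma$ the event-triggered closed-loop system $$x(k+1)=Ax(k)+BKx(k)-BKe_x(k)-Be_u(k),\qquad \|e_x(k)\|_2\le\sigma_x\|x(k)\|_2,\quad \|e_u(k)\|_2\le\sigma_u\|u(k)\|_2,\quad u(k)=K(x(k)-e_x(k)),$$ is asymptotically stable, with Lyapunov matrix $P=\bar P^{-1}$.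
   Context: Dimensions and data. $n_x,n_u,n_d,T$ are positive integers; $E\in\mathbb{R}^{n_x\times n_d}$ is known. The plant is $x(k+1)=A_*x(k)+B_*\hat u(k)+Ed(k)$ with unknown stabilizable $(A_*,B_* )$, $A_*\in\mathbb{R}^{n_x\times n_x}$, $B_*\in\mathbb{R}^{n_x\times n_u}$. In a data collection experiment, with $x(k+1)=A_*x(k)+B_*u(k)+Ed(k)$, one records $x_m(k)=x(k)+\delta_x(k)$ ($k=0,\dots,T$) and $u_m(k)=u(k)+\delta_u(k)$ ($k=0,\dots,T-1$), where $\|d(k)\|_2\le\epsilon_d$ and $\|\delta_u(k)\|_2\le\epsilon_u$ for $k=0,\dots,T-1$ and $\|\delta_x(k)\|_2\le\epsilon_x$ for $k=0,\dots,T$, with known constants $\epsilon_d,\epsilon_x,\epsilon_u>0$. Define for $k=0,\dots,T-1$ $$\Psi_k=F\,\Pi\,F^\top-v_kv_k^\top,\quad F=\begin{bmatrix}E&0&I&0\\0&-I&0&0\\0&0&0&-I\end{bmatrix},\quad \Pi=\mathrm{blkdiag}(4\epsilon_d^2I,4\epsilon_x^2I,4\epsilon_x^2I,4\epsilon_u^2I),\quad v_k=\begin{bmatrix}x_m(k+1)\\-x_m(k)\\-u_m(k)\end{bmatrix},$$ where the block sizes in $\Pi$ are $n_d,n_x,n_x,n_u$ and the block rows of $F$ have sizes $n_x,n_x,n_u$. The uncertainty set is $$\Sigma=\bigcap_{k=0}^{T-1}\left\{(A,B)\in\mathbb{R}^{n_x\times n_x}\times\mathbb{R}^{n_x\times n_u}:\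 \begin{bmatrix}I\\ A^\top\\ B^\top\end{bmatrix}^\top\Psi_k\begin{bmatrix}I\\ A^\top\\ B^\top\end{bmatrix}\succeq0\right\}.$$ Block notation (block rows of sizes $n_x,n_x,n_u$): $\mathcal{B}_1(X_1,X_2,X_3)=\begin{bmatrix}0&0&0\\ X_1&0&0\\ X_2&-X_2&X_3\end{bmatrix}$ (block columns $n_x,n_x,n_u$), $\mathcal{B}_2(X_1,X_2)=\begin{bmatrix}X_1&X_2\\-X_1&0\\0&0\end{bmatrix}$ (block columns $n_u,n_x$), $\mathcal{T}(X)=\mathrm{blkdiag}(X,0,0)-\sum_{i=0}^{T-1}\theta_i\Psi_i$ (with $X\in\mathbb{R}^{n_x\times n_x}$). The symbol $*$ denotes blocks determined by symmetry; $\succeq0$ means symmetric positive semidefinite. Event-triggered closed loop. The controller is $u(k)=K\hat x(k)$, where $\hat x(k)$ is the most recently transmitted state and $\hat u(k)$ the most recently transmitted input; $e_x(k)=x(k)-\hat x(k)$, $e_u(k)=u(k)-\hat u(k)$. The triggering rules (transmit $x(k)$ when $\|x(k)-\hat x(k)\|_2>\sigma_x\|x(k)\|_2$; transmit $u(k)$ when $\|u(k)-\hat u(k)\|_2>\sigma_u\|u(k)\|_2$; first transmissions at $k=0$) guarantee the two stated error inequalities for all $k\in\mathbb{N}$, and these inequalities are the event-triggered condition. Asymptotically stable means: for any initial state $x(0)$, $\lim_{k\to\infty}\|x(k)\|_2=0$. ''With Lyapunov matrix $P$'' means that $V(k)=x(k)^\top Px(k)$, $P\succ0$, satisfies $V(k+1)\le\beta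 V(k)$ for all $k$. *)

(* Defs.v *)
From HB Require Import structures.
From mathcomp Require Export all_boot all_order all_algebra.
From mathcomp Require Export complex.
From mathcomp Require Export all_classical all_reals all_analysis.

Set Implicit Arguments.
Unset Strict Implicit.
Unset Printing Implicit Defensive.

Export Order.TTheory GRing.Theory Num.Theory.
Export numFieldNormedType.Exports.

#[export] Set Implicit Arguments.
#[export] Unset Strict Implicit.
#[export] Unset Printing Implicit Defensive.

Local Open Scope classical_set_scope.
Local Open Scope ring_scope.

(* Euclidean norm; the library norm on matrices is the sup norm. *)
Definition norm2 (R : realType) (n : nat) (v : 'cV[R]_n) : R :=
  Num.sqrt (\sum_(i < n) v i ord0 ^+ 2).

Definition quad (R : realType) (n : nat) (M : 'M[R]_n) (v : 'cV[R]_n) : R :=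
  (v^T *m M *m v) ord0 ord0.

Definition psd (R : realType) (n : nat) (M : 'M[R]_n) : Prop :=
  M^T = M /\ forall v : 'cV[R]_n, 0 <= quad M v.

Definition posdef (R : realType) (n : nat) (M : 'M[R]_n) : Prop :=
  M^T = M /\ forall v : 'cV[R]_n, v != 0 -> 0 < quad M v.

Definition col3 (R : realType) (m1 m2 m3 n : nat)
    (X1 : 'M[R]_(m1, n)) (X2 : 'M[R]_(m2, n)) (X3 : 'M[R]_(m3, n)) :
    'M[R]_(m1 + (m2 + m3), n) :=
  col_mx X1 (col_mx X2 X3).

Definition row3 (R : realType) (m n1 n2 n3 : nat)
    (X1 : 'M[R]_(m, n1)) (X2 : 'M[R]_(m, n2)) (X3 : 'M[R]_(m, n3)) :
    'M[R]_(m, n1 + (n2 + n3)) :=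
  row_mx X1 (row_mx X2 X3).

Definition row4 (R : realType) (m n1 n2 n3 n4 : nat)
    (X1 : 'M[R]_(m, n1)) (X2 : 'M[R]_(m, n2)) (X3 : 'M[R]_(m, n3))
    (X4 : 'M[R]_(m, n4)) : 'M[R]_(m, n1 + (n2 + (n3 + n4))) :=
  row_mx X1 (row3 X2 X3 X4).

Definition blkdiag2 (R : realType) (n1 n2 : nat)
    (X1 : 'M[R]_n1) (X2 : 'M[R]_n2) : 'M[R]_(n1 + n2) :=
  block_mx X1 0 0 X2.

Definition blkdiag3 (R : realType) (n1 n2 n3 : nat)
    (X1 : 'M[R]_n1) (X2 : 'M[R]_n2) (X3 : 'M[R]_n3) :
    'M[R]_(n1 + (n2 + n3)) :=
  blkdiag2 X1 (blkdiag2 X2 X3).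

Definition blkdiag4 (R : realType) (n1 n2 n3 n4 : nat)
    (X1 : 'M[R]_n1) (X2 : 'M[R]_n2) (X3 : 'M[R]_n3) (X4 : 'M[R]_n4) :
    'M[R]_(n1 + (n2 + (n3 + n4))) :=
  blkdiag2 X1 (blkdiag3 X2 X3 X4).

(* [ M11 M12 M13 ; * M22 M23 ; * * M33 ], lower blocks filled by symmetry. *)
Definition symblock3 (R : realType) (n1 n2 n3 : nat)
    (M11 : 'M[R]_n1) (M12 : 'M[R]_(n1, n2)) (M13 : 'M[R]_(n1, n3))
    (M22 : 'M[R]_n2) (M23 : 'M[R]_(n2, n3)) (M33 : 'M[R]_n3) :
    'M[R]_(n1 + (n2 + n3)) :=
  col3 (row3 M11 M12 M13)
       (row3 M12^T M22 M23)
       (row3 M13^T M23^T M33).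

(* All complex eigenvalues lie in the open unit disk. *)
Definition schur_stable (R : realType) (n : nat) (M : 'M[R]_n) : Prop :=
  forall z : complex R,
    eigenvalue (map_mx (real_complex R) M) z -> `|z| < 1.

Definition stabilizable (R : realType) (nx nu : nat)
    (A : 'M[R]_nx) (B : 'M[R]_(nx, nu)) : Prop :=
  exists K : 'M[R]_(nu, nx), schur_stable (A + B *m K).

(* xm and um are noisy records of one run of the plant (As, Bs); only the
   samples xm 0, ..., xm T and um 0, ..., um (T - 1) are constrained. *)
Definition experiment_data (R : realType) (nx nu nd T : nat)
    (As : 'M[R]_nx) (Bs : 'M[R]_(nx, nu)) (E : 'M[R]_(nx, nd))
    (epsd epsx epsu : R)
    (xm : nat -> 'cV[R]_nx) (um : nat -> 'cV[R]_nu) : Prop :=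
  exists (x : nat -> 'cV[R]_nx) (u : nat -> 'cV[R]_nu)
         (d : nat -> 'cV[R]_nd)
         (deltax : nat -> 'cV[R]_nx) (deltau : nat -> 'cV[R]_nu),
    (forall k, (k < T)%N ->
       [/\ x k.+1 = As *m x k + Bs *m u k + E *m d k,
           um k = u k + deltau k,
           norm2 (d k) <= epsd
         & norm2 (deltau k) <= epsu]) /\
    (forall k, (k <= T)%N ->
       xm k = x k + deltax k /\ norm2 (deltax k) <= epsx).

Definition Fmx (R : realType) (nx nu nd : nat) (E : 'M[R]_(nx, nd)) :
    'M[R]_(nx + (nx + nu), nd + (nx + (nx + nu))) :=
  col3 (row4 E 0 1%:M 0)
       (row4 0 (- 1%:M) 0 0)
       (row4 0 0 0 (- 1%:M)).

Definition Pimx (R : realType) (nx nu nd : nat) (epsd epsx epsu : R) :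
    'M[R]_(nd + (nx + (nx + nu))) :=
  blkdiag4 (4 * epsd ^+ 2)%:M (4 * epsx ^+ 2)%:M
           (4 * epsx ^+ 2)%:M (4 * epsu ^+ 2)%:M.

Definition vvec (R : realType) (nx nu : nat)
    (xm : nat -> 'cV[R]_nx) (um : nat -> 'cV[R]_nu) (k : nat) :
    'cV[R]_(nx + (nx + nu)) :=
  col3 (xm k.+1) (- xm k) (- um k).

Definition Psi (R : realType) (nx nu nd : nat) (E : 'M[R]_(nx, nd))
    (epsd epsx epsu : R)
    (xm : nat -> 'cV[R]_nx) (um : nat -> 'cV[R]_nu) (k : nat) :
    'M[R]_(nx + (nx + nu)) :=
  Fmx nu E *m Pimx nx nu nd epsd epsx epsu *m (Fmx nu E)^T
  - vvec xm um k *m (vvec xm um k)^T.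

Definition Sigma (R : realType) (nx nu nd T : nat) (E : 'M[R]_(nx, nd))
    (epsd epsx epsu : R)
    (xm : nat -> 'cV[R]_nx) (um : nat -> 'cV[R]_nu) :
    set ('M[R]_nx * 'M[R]_(nx, nu)) :=
  \bigcap_(k < T)
    [set AB | psd ((col3 1%:M AB.1^T AB.2^T)^T
                   *m Psi E epsd epsx epsu xm um k
                   *m col3 1%:M AB.1^T AB.2^T)].

Definition calB1 (R : realType) (nx nu : nat)
    (X1 : 'M[R]_nx) (X2 : 'M[R]_(nu, nx)) (X3 : 'M[R]_nu) :
    'M[R]_(nx + (nx + nu)) :=
  col3 (row3 0 0 0)
       (row3 X1 0 0)
       (row3 X2 (- X2) X3).

Definition calB2 (R : realType) (nx nu : nat)
    (X1 : 'M[R]_(nx, nu)) (X2 : 'M[R]_nx) :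
    'M[R]_(nx + (nx + nu), nu + nx) :=
  col3 (row_mx X1 X2)
       (row_mx (- X1) 0)
       (row_mx 0 0).

Definition calT (R : realType) (nx nu nd T : nat) (E : 'M[R]_(nx, nd))
    (epsd epsx epsu : R)
    (xm : nat -> 'cV[R]_nx) (um : nat -> 'cV[R]_nu)
    (theta : 'I_T -> R) (X : 'M[R]_nx) : 'M[R]_(nx + (nx + nu)) :=
  blkdiag3 X 0 0 - \sum_(i < T) theta i *: Psi E epsd epsx epsu xm um i.

Definition lmi (R : realType) (nx nu nd T : nat) (E : 'M[R]_(nx, nd))
    (epsd epsx epsu : R)
    (xm : nat -> 'cV[R]_nx) (um : nat -> 'cV[R]_nu)
    (sigmax sigmau beta : R)
    (Pb : 'M[R]_nx) (L : 'M[R]_(nu, nx)) (G : 'M[R]_nu)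
    (alpha1 alpha2 : R) (theta : 'I_T -> R) :
    'M[R]_((nx + (nx + nu)) + ((nx + (nx + nu)) + (nu + nx))) :=
  symblock3
    (calT E epsd epsx epsu xm um theta Pb)
    (calB1 Pb L (- G))
    0
    (blkdiag3 (beta *: Pb) (2 *: Pb - alpha1%:M) (G^T + G - alpha2%:M))
    (calB2 L^T Pb)
    (blkdiag2 (alpha2 / sigmau ^+ 2)%:M (alpha1 / sigmax ^+ 2)%:M).

(* State trajectories of the disturbance-free event-triggered loop; the
   triggering rules enter through the error bounds they enforce. *)
Definition et_closed_loop (R : realType) (nx nu : nat)
    (A : 'M[R]_nx) (B : 'M[R]_(nx, nu)) (K : 'M[R]_(nu, nx))
    (sigmax sigmau : R) : set (nat -> 'cV[R]_nx) :=
  [set x | exists (ex : nat -> 'cV[R]_nx) (eu u : nat -> 'cV[R]_nu),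
     forall k,
       [/\ x k.+1 = A *m x k + B *m K *m x k - B *m K *m ex k - B *m eu k,
           u k = K *m (x k - ex k),
           norm2 (ex k) <= sigmax * norm2 (x k)
         & norm2 (eu k) <= sigmau * norm2 (u k)]].

Definition asymptotically_stable (R : realType) (nx : nat)
    (S : set (nat -> 'cV[R]_nx)) : Prop :=
  forall (x0 : 'cV[R]_nx) (x : nat -> 'cV[R]_nx),
    S x -> x 0%N = x0 -> (fun k => norm2 (x k)) @ \oo --> (0 : R).

Definition lyapunov_matrix (R : realType) (nx : nat)
    (S : set (nat -> 'cV[R]_nx)) (beta : R) (P : 'M[R]_nx) : Prop :=
  posdef P /\
  forall x : nat -> 'cV[R]_nx,
    S x -> forall k, quad P (x k.+1) <= beta * quad P (x k).

(* Main.v *)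
Require Import Defs.
From mathcomp Require Import ring lra.

(** Write P for the inverse of Pb, K = L P, and fix (A, B) in the uncertainty
    set. The idea is to evaluate the quadratic form of the matrix inequality
    at the vector whose first block is (y, A^T y, B^T y). On such vectors each
    Psi_i contributes a nonnegative number weighted by theta_i, so the first
    diagonal block is at most y^T Pb y, and what is left no longer mentions
    the data: this is [lmi_form_ge0], an S-procedure in its easy direction.

    The remaining blocks are free. Along a trajectory one takes a = P x(k),
    b = P e_x(k) and c with G c = e_u(k), so that the cross term becomes
    2 y^T x(k+1); the choice y = - P x(k+1) turns the terms in y into
    - x(k+1)^T P x(k+1). It remains to see that the terms in (b, q) and those
    in (c, p) can be made nonpositive. By N^T + N - alpha I <= N^T N / alpha
    they are, for the optimal q and p, at most
    (|e_x|^2 - sigmax^2 |x|^2) / alpha1 and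
    (|e_u|^2 - sigmau^2 |u|^2) / alpha2, which the triggering rule makes
    nonpositive ([absorb_triggering_error]). This yields
    V(k+1) <= beta V(k) for V(k) = x(k)^T P x(k).

    The divisions need care, as alpha1 and alpha2 are only assumed
    nonnegative. A zero alpha1 contradicts the matrix inequality
    ([lmi_form_alpha1_gt0]). A zero alpha2 forces L = 0, so that u and
    therefore e_u vanish and there is nothing to absorb; a positive alpha2
    makes G invertible, so that c exists ([absorb_input_error]).

    Convergence of |x(k)| follows from |x|^2 <= tr(Pb) x^T P x, which avoids
    eigenvalues and compactness ([dot_le_trace_quad_invmx]). *)

Local Open Scope classical_set_scope.
Local Open Scope ring_scope.

(** * The Euclidean inner product and quadratic forms *)

Definition dot (R : realType) (n : nat) (u v : 'cV[R]_n) : R :=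
  (u^T *m v) ord0 ord0.

Lemma dotE (R : realType) n (u v : 'cV[R]_n) :
  dot u v = \sum_i u i ord0 * v i ord0.
Proof. by rewrite /dot mxE; apply: eq_bigr => i _; rewrite mxE. Qed.

Lemma dotC (R : realType) n (u v : 'cV[R]_n) : dot u v = dot v u.
Proof. by rewrite !dotE; apply: eq_bigr => i _; rewrite mulrC. Qed.

Lemma dotDr (R : realType) n (u v w : 'cV[R]_n) :
  dot u (v + w) = dot u v + dot u w.
Proof. by rewrite /dot mulmxDr mxE. Qed.

Lemma dotZr (R : realType) n a (u v : 'cV[R]_n) : dot u (a *: v) = a * dot u v.
Proof. by rewrite /dot -scalemxAr mxE. Qed.

Lemma dotNr (R : realType) n (u v : 'cV[R]_n) : dot u (- v) = - dot u v.
Proof. by rewrite -scaleN1r dotZr mulN1r. Qed.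

Lemma dotDl (R : realType) n (u v w : 'cV[R]_n) :
  dot (v + w) u = dot v u + dot w u.
Proof. by rewrite dotC dotDr !(dotC u). Qed.

Lemma dotZl (R : realType) n a (u v : 'cV[R]_n) : dot (a *: v) u = a * dot v u.
Proof. by rewrite dotC dotZr dotC. Qed.

Lemma dotNl (R : realType) n (u v : 'cV[R]_n) : dot (- v) u = - dot v u.
Proof. by rewrite dotC dotNr dotC. Qed.

Lemma dot0r (R : realType) n (u : 'cV[R]_n) : dot u 0 = 0.
Proof. by rewrite /dot mulmx0 mxE. Qed.

Lemma dot0l (R : realType) n (u : 'cV[R]_n) : dot 0 u = 0.
Proof. by rewrite dotC dot0r. Qed.

Lemma dot_mulmxl (R : realType) m n (M : 'M[R]_(m, n)) u v :
  dot (M *m u) v = dot u (M^T *m v).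
Proof. by rewrite /dot trmx_mul mulmxA. Qed.

Lemma dot_col_mx (R : realType) m n (u1 v1 : 'cV[R]_m) (u2 v2 : 'cV[R]_n) :
  dot (col_mx u1 u2) (col_mx v1 v2) = dot u1 v1 + dot u2 v2.
Proof. by rewrite /dot tr_col_mx mul_row_col mxE. Qed.

Lemma dot_ge0 (R : realType) n (u : 'cV[R]_n) : 0 <= dot u u.
Proof. by rewrite dotE sumr_ge0 // => i _; rewrite -expr2 sqr_ge0. Qed.

Lemma dot_eq0 (R : realType) n (u : 'cV[R]_n) : dot u u = 0 -> u = 0.
Proof.
rewrite dotE => /eqP; rewrite psumr_eq0; last first.
  by move=> i _; rewrite -expr2 sqr_ge0.
move=> /allP u0; apply/colP => i; rewrite mxE; apply/eqP.
by move: (u0 i (mem_index_enum i)); rewrite mulf_eq0 orbb.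
Qed.

Lemma norm2_ge0 (R : realType) n (u : 'cV[R]_n) : 0 <= norm2 u.
Proof. exact: sqrtr_ge0. Qed.

Lemma sqr_norm2 (R : realType) n (u : 'cV[R]_n) : norm2 u ^+ 2 = dot u u.
Proof.
rewrite dotE sqr_sqrtr; first by apply: eq_bigr => i _; rewrite expr2.
by apply: sumr_ge0 => i _; rewrite sqr_ge0.
Qed.

Lemma norm2_le_dot (R : realType) m n (s : R) (u : 'cV[R]_m) (v : 'cV[R]_n) :
  0 <= s -> norm2 u <= s * norm2 v -> dot u u <= s ^+ 2 * dot v v.
Proof.
move=> s0 uv; rewrite -!sqr_norm2 -exprMn ler_sqr // nnegrE ?norm2_ge0 //.
by rewrite mulr_ge0 // norm2_ge0.
Qed.

Lemma quadE (R : realType) n (M : 'M[R]_n) u : quad M u = dot u (M *m u).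
Proof. by rewrite /quad /dot mulmxA. Qed.

Lemma quad0 (R : realType) n (M : 'M[R]_n) : quad M 0 = 0.
Proof. by rewrite quadE dot0l. Qed.

Lemma quadN (R : realType) n (M : 'M[R]_n) u : quad M (- u) = quad M u.
Proof. by rewrite !quadE mulmxN dotNl dotNr opprK. Qed.

Lemma quadZ (R : realType) n a (M : 'M[R]_n) u : quad (a *: M) u = a * quad M u.
Proof. by rewrite !quadE -scalemxAl dotZr. Qed.

Lemma quadB (R : realType) n (M N : 'M[R]_n) u :
  quad (M - N) u = quad M u - quad N u.
Proof. by rewrite !quadE mulmxBl dotDr dotNr. Qed.

Lemma quad_scalar (R : realType) n (a : R) (u : 'cV[R]_n) :
  quad a%:M u = a * dot u u.
Proof. by rewrite quadE mul_scalar_mx dotZr. Qed.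

Lemma quad_sum (R : realType) n T (M : 'I_T -> 'M[R]_n) u :
  quad (\sum_i M i) u = \sum_i quad (M i) u.
Proof.
by rewrite /quad mulmx_sumr mulmx_suml summxE.
Qed.

Lemma quad_mulmx (R : realType) m n (M : 'M[R]_m) (N : 'M[R]_(m, n)) u :
  quad M (N *m u) = quad (N^T *m M *m N) u.
Proof. by rewrite /quad trmx_mul !mulmxA. Qed.

Lemma quad_blkdiag2 (R : realType) m n (M : 'M[R]_m) (N : 'M[R]_n) u v :
  quad (blkdiag2 M N) (col_mx u v) = quad M u + quad N v.
Proof. by rewrite !quadE mul_block_col !mul0mx addr0 add0r dot_col_mx. Qed.

Lemma quad_symblock3 (R : realType) n1 n2 n3
    (M11 : 'M[R]_n1) (M12 : 'M[R]_(n1, n2)) (M13 : 'M[R]_(n1, n3))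
    (M22 : 'M[R]_n2) (M23 : 'M[R]_(n2, n3)) (M33 : 'M[R]_n3) u v w :
  quad (symblock3 M11 M12 M13 M22 M23 M33) (col3 u v w) =
  quad M11 u + quad M22 v + quad M33 w
  + 2 * (dot u (M12 *m v) + dot u (M13 *m w) + dot v (M23 *m w)).
Proof.
rewrite !quadE !mul_col_mx !mul_row_col !dot_col_mx !dotDr.
rewrite -(dot_mulmxl M12) -(dot_mulmxl M13) -(dot_mulmxl M23).
rewrite (dotC (M12 *m v)) (dotC (M13 *m w)) (dotC (M23 *m w)).
ring.
Qed.

(** * Positive definite matrices *)

(** Stated for possibly nonsymmetric M, to serve for G as well: the matrix
    inequality controls only the symmetric part of G. *)
Lemma pos_quad_unitmx (R : realType) n (M : 'M[R]_n) :
  (forall v, v != 0 -> 0 < quad M v) -> M \in unitmx.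
Proof.
move=> Mpos; rewrite unitmxE unitfE; apply/negP => /det0P[v v0 vM].
have := Mpos v^T; rewrite trmx_eq0 => /(_ v0).
by rewrite /quad trmxK vM mul0mx mxE ltxx.
Qed.

Lemma posdef_unitmx (R : realType) n (M : 'M[R]_n) : posdef M -> M \in unitmx.
Proof. by case=> _; exact: pos_quad_unitmx. Qed.

Lemma trmx_invmx_posdef (R : realType) n (M : 'M[R]_n) :
  posdef M -> (invmx M)^T = invmx M.
Proof. by move=> [MT _]; rewrite trmx_inv MT. Qed.

Lemma quad_invmx (R : realType) n (M : 'M[R]_n) u :
  posdef M -> quad (invmx M) u = quad M (invmx M *m u).
Proof.
move=> Mpos; rewrite quad_mulmx trmx_invmx_posdef // mulVmx ?mul1mx //.
exact: posdef_unitmx.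
Qed.

Lemma posdef_invmx (R : realType) n (M : 'M[R]_n) :
  posdef M -> posdef (invmx M).
Proof.
move=> Mpos; have Mu : M \in unitmx by exact: posdef_unitmx.
split=> [|v v0]; first exact: trmx_invmx_posdef.
rewrite quad_invmx //; apply: (Mpos.2); apply: contra_neq v0 => Mv.
by rewrite -(mulKVmx Mu v) Mv mulmx0.
Qed.

Lemma quad_posdef_ge0 (R : realType) n (M : 'M[R]_n) u :
  posdef M -> 0 <= quad M u.
Proof.
by move=> [_ Mpos]; have [->|/Mpos/ltW//] := eqVneq u 0; rewrite quad0.
Qed.

(** Coordinatewise Cauchy-Schwarz for the inner product of the inverse matrix:
    u_i is the product of u with M e_i, whose square norm is M_ii, so that
    u_i^2 <= M_ii * quad (invmx M) u; then sum over i. *)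
Lemma dot_le_trace_quad_invmx (R : realType) n (M : 'M[R]_n) u :
  posdef M -> dot u u <= \tr M * quad (invmx M) u.
Proof.
move=> Mpos; have Mu : M \in unitmx by exact: posdef_unitmx.
rewrite dotE /mxtrace mulr_suml; apply: ler_sum => i _.
pose e : 'cV[R]_n := delta_mx i ord0.
have dote v : dot e v = v i ord0.
  by rewrite /dot trmx_delta -rowE mxE.
have quade : quad M e = M i i by rewrite quadE dote -colE mxE.
have e0 : 0 < M i i.
  rewrite -quade; apply: (Mpos.2); apply/eqP => /colP/(_ i) /eqP.
  by rewrite !mxE !eqxx oner_eq0.
(* t minimises the square norm of u - t M e_i. *)
pose t := u i ord0 / M i i.
have := quad_posdef_ge0 (u - t *: (M *m e)) (posdef_invmx Mpos).
rewrite quadE mulmxBr -scalemxAr mulKmx // !dotDr !dotDl !dotNr !dotNl.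
rewrite !dotZr !dotZl (dot_mulmxl M) (Mpos.1) mulKVmx //.
rewrite (dotC u e) (dotC (M *m e)) !dote -colE [col i M i ord0]mxE -quadE.
have -> : t * M i i = u i ord0 by rewrite divfK // gt_eqF.
rewrite /t => h; rewrite -ler_pdivrMl // mulrC.
have : 0 <= quad (invmx M) u - u i ord0 / M i i * u i ord0 by move: h; lra.
by rewrite subr_ge0 mulrAC.
Qed.

(** * Absorption of the triggering errors *)

(** This is |N v - a v|^2 >= 0, divided by a. *)
Lemma quad_slack_le (R : realType) n (N : 'M[R]_n) (a : R) v :
  0 < a -> quad (N^T + N - a%:M) v <= a^-1 * dot (N *m v) (N *m v).
Proof.
move=> a0; rewrite quadB quad_scalar quadE mulmxDl dotDr -dot_mulmxl.
rewrite ler_pdivlMl //.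
have := dot_ge0 (N *m v - a *: v).
rewrite !dotDr !dotDl !dotNr !dotNl !dotZr !dotZl (dotC v (N *m v)); lra.
Qed.

(** The last two terms of the sum are minimised by p = - (s^2 / a) z, with
    minimum - (s^2 / a) |z|^2; this outweighs the first one, which is at most
    |N v|^2 / a. It is used with N v equal to a triggering error and z to the
    signal against which that error is measured. *)
Lemma absorb_triggering_error (R : realType) m n (N : 'M[R]_m) (a s : R)
    (v : 'cV[R]_m) (z : 'cV[R]_n) :
  0 < a -> 0 < s -> dot (N *m v) (N *m v) <= s ^+ 2 * dot z z ->
  exists p : 'cV[R]_n,
    quad (N^T + N - a%:M) v + quad (a / s ^+ 2)%:M p + 2 * dot p z <= 0.
Proof.
move=> a0 s0 Nvz; exists (- (s ^+ 2 / a) *: z).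
have h1 := quad_slack_le N v a0.
have h2 : a^-1 * dot (N *m v) (N *m v) <= a^-1 * (s ^+ 2 * dot z z).
  by rewrite ler_pM2l // invr_gt0.
rewrite quad_scalar !dotZr !dotZl.
have -> : a / s ^+ 2 * (- (s ^+ 2 / a) * (- (s ^+ 2 / a) * dot z z)) =
          a^-1 * (s ^+ 2 * dot z z) by field; rewrite !gt_eqF.
rewrite mulrA in h2 *; lra.
Qed.

(** * Elimination of the uncertain plant *)

(** The quadratic form of [lmi] at the vector with blocks
    (y, A^T y, B^T y), (a, b, c) and (p, q), with y^T Pb y in place of the value
    of the data-dependent block [calT], and 2 Pb written Pb^T + Pb to match the
    shape of the block in G. The summands are grouped by channel:
    the state error carried by (b, q), then the input error by (c, p). *)
Definition lmi_form (R : realType) nx nu (A : 'M[R]_nx) (B : 'M[R]_(nx, nu))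
    (Pb : 'M[R]_nx) (L : 'M[R]_(nu, nx)) (G : 'M[R]_nu)
    (alpha1 alpha2 sigmax sigmau beta : R)
    (y a b : 'cV[R]_nx) (c p : 'cV[R]_nu) (q : 'cV[R]_nx) : R :=
  quad Pb y
  + 2 * dot y (A *m (Pb *m a) + B *m (L *m a) - B *m (L *m b) - B *m (G *m c))
  + beta * quad Pb a
  + (quad (Pb^T + Pb - alpha1%:M) b + quad (alpha1 / sigmax ^+ 2)%:M q
     + 2 * dot q (Pb *m a))
  + (quad (G^T + G - alpha2%:M) c + quad (alpha2 / sigmau ^+ 2)%:M p
     + 2 * dot p (L *m (a - b))).

(** Membership in Sigma says that each Psi_i is nonnegative on the vectors
    (y, A^T y, B^T y), so the terms - theta_i Psi_i can be dropped from
    [calT]. *)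
Lemma lmi_form_ge0 (R : realType) nx nu nd T (E : 'M[R]_(nx, nd))
    (epsd epsx epsu : R) xm um sigmax sigmau beta
    (Pb : 'M[R]_nx) (L : 'M[R]_(nu, nx)) (G : 'M[R]_nu) alpha1 alpha2
    (theta : 'I_T -> R) A B :
  Pb^T = Pb -> (forall i, 0 <= theta i) ->
  psd (lmi E epsd epsx epsu xm um sigmax sigmau beta
           Pb L G alpha1 alpha2 theta) ->
  Sigma T E epsd epsx epsu xm um (A, B) ->
  forall y a b c p q,
  0 <= lmi_form A B Pb L G alpha1 alpha2 sigmax sigmau beta y a b c p q.
Proof.
move=> Pbsym theta0 [_ lmi0] AB y a b c p q.
pose M := col3 1%:M A^T B^T.
have T_le : quad (calT E epsd epsx epsu xm um theta Pb) (M *m y) <= quad Pb y.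
  have ME : M *m y = col_mx y (col_mx (A^T *m y) (B^T *m y)).
    by rewrite /M !mul_col_mx mul1mx.
  rewrite quadB quad_sum lerBlDr ME /blkdiag3 !quad_blkdiag2 -ME.
  rewrite !(quadE 0) !mul0mx !dot0r !addr0 lerDl; apply: sumr_ge0 => i _.
  rewrite quadZ mulr_ge0 // quad_mulmx.
  by have [_] := AB i (ltn_ord i); apply.
have := lmi0 (col3 (M *m y) (col3 a b c) (col_mx p q)).
rewrite quad_symblock3 !quad_blkdiag2 mul0mx dot0r addr0 quadZ.
rewrite /M !mul_col_mx !mul_row_col !mul0mx !add0r !addr0 mul1mx.
rewrite !dot_col_mx !dot_mulmxl !trmxK dot0r dot0r !addr0 !add0r.
move: T_le; rewrite /M !mul_col_mx mul1mx => T_le.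
rewrite /lmi_form Pbsym -[Pb + Pb]mulr2n -(scaler_nat 2 Pb).
rewrite !mulNmx !mulmxDr !mulmxN !dotDr !dotNr.
rewrite -(dot_mulmxl L a) -(dot_mulmxl L b) (dotC p) (dotC p).
have -> : dot a (Pb *m q) = dot q (Pb *m a).
  by rewrite dotC dot_mulmxl Pbsym.
lra.
Qed.

(** * Degenerate multipliers *)

(** With alpha1 = 0 the form is affine in q, with slope 2 Pb a, hence
    unbounded below when a is nonzero; already q = - a, with
    the other blocks zero, gives (beta - 2) * quad Pb a < 0. *)
Lemma lmi_form_alpha1_gt0 (R : realType) nx nu
    (A : 'M[R]_nx) (B : 'M[R]_(nx, nu))
    (Pb : 'M[R]_nx) (L : 'M[R]_(nu, nx)) (G : 'M[R]_nu)
    alpha1 alpha2 sigmax sigmau beta :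
  (0 < nx)%N -> posdef Pb -> 0 <= alpha1 -> beta < 1 ->
  (forall y a b c p q,
     0 <= lmi_form A B Pb L G alpha1 alpha2 sigmax sigmau beta y a b c p q) ->
  0 < alpha1.
Proof.
move=> nx0 [_ Pbpos] alpha1ge beta1 lmi0.
rewrite lt_def alpha1ge andbT; apply/eqP => alpha10.
pose a : 'cV[R]_nx := delta_mx (Ordinal nx0) ord0.
have a0 : a != 0.
  by apply/eqP => /colP/(_ (Ordinal nx0)) /eqP; rewrite !mxE !eqxx oner_eq0.
have := lmi0 0 a 0 0 0 (- a).
rewrite /lmi_form alpha10 !quad0 !dot0l !quad_scalar !mul0r dotNl -quadE.
have := Pbpos a a0; nra.
Qed.

(** With alpha2 = 0 the form is affine in p, so nonnegativity forces its
    slope, which is 2 L a at b = 0, to vanish. *)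
Lemma lmi_form_alpha2_eq0 (R : realType) nx nu
    (A : 'M[R]_nx) (B : 'M[R]_(nx, nu))
    (Pb : 'M[R]_nx) (L : 'M[R]_(nu, nx)) (G : 'M[R]_nu)
    alpha1 sigmax sigmau beta :
  (forall y a b c p q,
     0 <= lmi_form A B Pb L G alpha1 0 sigmax sigmau beta y a b c p q) ->
  forall a : 'cV[R]_nx, L *m a = 0.
Proof.
move=> lmi0 a; apply: dot_eq0; apply/eqP.
rewrite eq_le dot_ge0 andbT leNgt; apply/negP => La0.
(* t makes the form negative at p = - t L a: beta * quad Pb a - 2 t |L a|^2. *)
pose t := (`|beta * quad Pb a| + 1) / dot (L *m a) (L *m a).
have := lmi0 0 a 0 0 (- t *: (L *m a)) 0.
rewrite /lmi_form !quad0 !dot0l !quad_scalar !mul0r subr0 dotZl.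
rewrite mulNr divfK ?gt_eqF //.
have := ler_norm (beta * quad Pb a); have := normr_ge0 (beta * quad Pb a); lra.
Qed.

(** The symmetric part of G dominates alpha2 / 2 times the identity. *)
Lemma lmi_form_G_unitmx (R : realType) nx nu (A : 'M[R]_nx) (B : 'M[R]_(nx, nu))
    (Pb : 'M[R]_nx) (L : 'M[R]_(nu, nx)) (G : 'M[R]_nu)
    alpha1 alpha2 sigmax sigmau beta :
  0 < alpha2 ->
  (forall y a b c p q,
     0 <= lmi_form A B Pb L G alpha1 alpha2 sigmax sigmau beta y a b c p q) ->
  G \in unitmx.
Proof.
move=> alpha20 lmi0; apply: pos_quad_unitmx => v v0.
have vv : 0 < dot v v.
  rewrite lt_def dot_ge0 andbT.
  by apply: contra_neq v0 => /dot_eq0.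
have := lmi0 0 0 0 v 0 0.
rewrite /lmi_form subr0 !quad0 !dot0l quadB quad_scalar quadE mulmxDl dotDr.
rewrite -dot_mulmxl (dotC (G *m v)) -quadE.
have := mulr_gt0 alpha20 vv; lra.
Qed.

(** The case distinction on alpha2 is hidden here: if alpha2 = 0, then L a = 0
    and eu = 0, so that c = p = 0 works even though G may be singular. *)
Lemma absorb_input_error (R : realType) nx nu
    (A : 'M[R]_nx) (B : 'M[R]_(nx, nu))
    (Pb : 'M[R]_nx) (L : 'M[R]_(nu, nx)) (G : 'M[R]_nu)
    alpha1 alpha2 sigmax sigmau beta a eu :
  0 < sigmau -> 0 <= alpha2 ->
  (forall y a b c p q,
     0 <= lmi_form A B Pb L G alpha1 alpha2 sigmax sigmau beta y a b c p q) ->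
  dot eu eu <= sigmau ^+ 2 * dot (L *m a) (L *m a) ->
  exists c p, G *m c = eu /\
    quad (G^T + G - alpha2%:M) c + quad (alpha2 / sigmau ^+ 2)%:M p
    + 2 * dot p (L *m a) <= 0.
Proof.
move=> sigmau0; rewrite le_eqVlt => /predU1P[<-|alpha20] lmi0 eule.
  have La0 := lmi_form_alpha2_eq0 lmi0 a.
  exists 0, 0; split; last by rewrite !quad0 dot0l mulr0 !addr0.
  rewrite mulmx0; apply/esym/dot_eq0/eqP; rewrite eq_le dot_ge0 andbT.
  by rewrite (le_trans eule) // La0 dot0l mulr0.
have Gu := lmi_form_G_unitmx alpha20 lmi0.
have [|p pP] := @absorb_triggering_error R _ _ G alpha2 sigmau (invmx G *m eu)
  (L *m a) alpha20 sigmau0; first by rewrite mulKVmx.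
by exists (invmx G *m eu), p; rewrite mulKVmx.
Qed.

(** * Decrease of the Lyapunov function and convergence *)

Lemma cvg_norm2_of_geometric_decay (R : realType) n (P : 'M[R]_n) beta
    (x : nat -> 'cV[R]_n) :
  posdef P -> 0 < beta -> beta < 1 ->
  (forall k, quad (invmx P) (x k.+1) <= beta * quad (invmx P) (x k)) ->
  ((fun k => norm2 (x k)) @ \oo --> (0 : R))%classic.
Proof.
move=> Ppos beta0 beta1 dec.
have trP : 0 <= \tr P.
  apply: sumr_ge0 => i _.
  have := quad_posdef_ge0 (delta_mx i ord0) Ppos.
  by rewrite /quad trmx_delta -rowE -colE !mxE.
have dec0 k : quad (invmx P) (x k) <= quad (invmx P) (x 0%N) * beta ^+ k.
  elim: k => [|k IH]; first by rewrite expr0 mulr1.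
  by rewrite (le_trans (dec k)) // exprS mulrCA ler_pM2l.
pose C := \tr P * quad (invmx P) (x 0%N).
have C0 : 0 <= C by rewrite mulr_ge0 // quad_posdef_ge0 //; apply: posdef_invmx.
have bound k : norm2 (x k) <= Num.sqrt C * Num.sqrt beta ^+ k.
  rewrite -ler_sqr ?nnegrE ?norm2_ge0 ?mulr_ge0 ?exprn_ge0 ?sqrtr_ge0 //.
  rewrite sqr_norm2 exprMn exprAC !sqr_sqrtr // ?(ltW beta0) //.
  by rewrite (le_trans (dot_le_trace_quad_invmx _ Ppos)) // -mulrA ler_wpM2l.
apply: (@squeeze_cvgr _ _ _ _ (fun=> 0)
  (fun k => Num.sqrt C * Num.sqrt beta ^+ k)).
- by apply: nearW => k; rewrite norm2_ge0 bound.
- exact: cvg_cst.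
- rewrite -(mulr0 (Num.sqrt C)); apply: cvgMr; apply: cvg_expr.
  by rewrite ger0_norm ?sqrtr_ge0 // -sqrtr1 ltr_sqrt.
Qed.

Theorem theorem1 (R : realType) (nx nu nd T : nat)
  (hnx : (0 < nx)%N) (hnu : (0 < nu)%N) (hnd : (0 < nd)%N) (hT : (0 < T)%N)
  (E : 'M[R]_(nx, nd))
  (As : 'M[R]_nx) (Bs : 'M[R]_(nx, nu)) (hstab : stabilizable As Bs)
  (epsd epsx epsu : R) (hepsd : 0 < epsd) (hepsx : 0 < epsx) (hepsu : 0 < epsu)
  (xm : nat -> 'cV[R]_nx) (um : nat -> 'cV[R]_nu)
  (hdata : experiment_data T As Bs E epsd epsx epsu xm um)
  (sigmax sigmau beta : R) (hsigmax : 0 < sigmax) (hsigmau : 0 < sigmau)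
  (hbeta0 : 0 < beta) (hbeta1 : beta < 1)
  (Pb : 'M[R]_nx) (L : 'M[R]_(nu, nx)) (G : 'M[R]_nu)
  (alpha1 alpha2 : R) (theta : 'I_T -> R)
  (hPb : posdef Pb) (halpha1 : 0 <= alpha1) (halpha2 : 0 <= alpha2)
  (htheta : forall i : 'I_T, 0 <= theta i)
  (hlmi : psd (lmi E epsd epsx epsu xm um sigmax sigmau beta
                   Pb L G alpha1 alpha2 theta)) :
  forall (A : 'M[R]_nx) (B : 'M[R]_(nx, nu)),
    Sigma T E epsd epsx epsu xm um (A, B) ->
    asymptotically_stable
      (et_closed_loop A B (L *m invmx Pb) sigmax sigmau) /\
    lyapunov_matrix
      (et_closed_loop A B (L *m invmx Pb) sigmax sigmau) beta (invmx Pb).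
Proof.
move=> A B AB.
have Pbu := posdef_unitmx hPb.
suff decrease x : et_closed_loop A B (L *m invmx Pb) sigmax sigmau x ->
    forall k, quad (invmx Pb) (x k.+1) <= beta * quad (invmx Pb) (x k).
  split=> [x0 x xsol _|]; last by split; [exact: posdef_invmx|].
  exact: cvg_norm2_of_geometric_decay hPb hbeta0 hbeta1 (decrease x xsol).
move=> [ex [eu [u xsol]]] k; have [xk1 uk exk euk] := xsol k.
pose a := invmx Pb *m x k; pose b := invmx Pb *m ex k.
have uE : u k = L *m (a - b) by rewrite uk /a /b -mulmxBr mulmxA.
have form0 := lmi_form_ge0 (hPb.1) htheta hlmi AB.
have alpha10 := lmi_form_alpha1_gt0 hnx hPb halpha1 hbeta1 form0.
have [|q qP] := @absorb_triggering_error R _ _ Pb alpha1 sigmax b (x k)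
  alpha10 hsigmax.
  by rewrite mulKVmx //; apply: norm2_le_dot => //; exact: ltW.
have [|c [p [Gc pP]]] := absorb_input_error (eu := eu k) (a := a - b)
  hsigmau halpha2 form0.
  by rewrite -uE; apply: norm2_le_dot => //; exact: ltW.
have := form0 (- (invmx Pb *m x k.+1)) a b c p q.
rewrite /lmi_form (hPb.1) Gc mulKVmx //.
(* By the choice of a, b and c the cross term is the next state, and
   y = - P x(k+1) makes quad Pb y + 2 y^T x(k+1) equal to - V(k+1). *)
have -> : A *m x k + B *m (L *m a) - B *m (L *m b) - B *m eu k = x k.+1.
  by rewrite xk1 /a /b !mulmxA.
rewrite quadN dotNl -!quad_invmx // dotC -quadE.
by move: qP pP; rewrite (hPb.1); lra.
Qed.
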